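(* Let $G$ be a triangle-free graph of order $n$. Then $\phi'(G)\le 6^{n/4}$. Furthermore, $\phi'(G)=6^{n/4}$ if and only if $n\equiv 0\pmod 4$ and $G$ is isomorphic to the disjoint union of $n/4$ copies of $C_4$.
   Context: All graphs are finite, simple, undirected and labeled. A subset $F$ of vertices of a graph $G$ is a dissociation set if the induced subgraph $G[F]$ has maximum degree at most $1$. A maximum dissociation set is a dissociation set of maximum cardinality. $\phi'(G)$ denotes the number of maximum dissociation sets of $G$. *)

(* Defs.v *)
From mathcomp Require Import all_boot.
Set Implicit Arguments. Unset Strict Implicit. Unset Printing Implicit Defensive.


Definition simple_graph (T : finType) (e : rel T) : Prop :=
  symmetric e /\ irreflexive e.

Definition triangle_free (T : finType) (e : rel T) : Prop :=
  forall x y z : T, ~~ [&& e x y, e y z & e x z].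

Definition dissociation (T : finType) (e : rel T) (F : {set T}) : bool :=
  [forall x in F, #|[set y in F | e x y]| <= 1].

Definition diss_num (T : finType) (e : rel T) : nat :=
  \max_(F : {set T} | dissociation e F) #|F|.

Definition max_dissociation (T : finType) (e : rel T) (F : {set T}) : bool :=
  dissociation e F && (#|F| == diss_num e).

Definition num_max_diss (T : finType) (e : rel T) : nat :=
  #|[set F : {set T} | max_dissociation e F]|.

Definition C4_union_rel (k : nat) : rel ('I_k * 'I_4) :=
  fun u v => (u.1 == v.1) &&
    (((u.2 : nat) == (v.2 + 1) %% 4) || ((v.2 : nat) == (u.2 + 1) %% 4)).
Arguments C4_union_rel k : clear implicits.

Definition isomorphic (T T' : finType) (e : rel T) (e' : rel T') : Prop :=
  exists f : T -> T', bijective f /\ forall x y, e' (f x) (f y) = e x y.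

(* Main.v *)
(** It suffices to bound the number [phi S] of inclusion-maximal dissociation
    sets of each induced subgraph G[S].  With t = 6^(-1/4), put
    rho S = phi S * t^|S|; by induction on |S|, rho S <= 1, with equality only
    for disjoint unions of 4-cycles.  Fixing the trace A of a maximal set on a
    set R containing N[A] leaves a maximal set of G[S \ R], so [phi S] is at most
    a sum of terms [phi (S \ R)], each contributing at most t^|R| to rho S.
    Triangle-freeness gives |N(u) U N(v)| = deg u + deg v on an edge uv.
    Branching on a vertex of degree at most 1 or at least 4, on a vertex of
    degree 2 next to one of degree 3, on a vertex of a cycle other than C_4, or
    on a vertex of a cubic graph (whose deletion creates vertices of degree 2
    next to vertices of degree 3) gives rho S < 1 numerically.  A C_4 component
    C gives phi S <= 6 phi (S \ C), i.e., rho S <= rho (S \ C). *)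

Require Import Defs.
From mathcomp Require Import all_boot all_order all_algebra realalg.
From mathcomp Require Import zify lra.
Set Implicit Arguments. Unset Strict Implicit. Unset Printing Implicit Defensive.
Import Order.TTheory GRing.Theory Num.Theory.

Lemma dissociationP (T : finType) (e : rel T) (F : {set T}) :
  reflect (forall x y z, x \in F -> y \in F -> z \in F -> e x y -> e x z -> y = z)
          (dissociation e F).
Proof.
apply: (iffP forall_inP) => [dF x y z Fx Fy Fz exy exz | dF x Fx].
  by move/card_le1_eqP: (dF x Fx); apply; rewrite inE ?Fy ?Fz.
by apply/card_le1_eqP => y z; rewrite !inE => /andP[? ?] /andP[? ?]; apply: (dF x).
Qed.

Section Counting.

Variables (T : finType) (e : rel T).
Hypotheses (sym_e : symmetric e) (irr_e : irreflexive e).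
Hypothesis tf_e : triangle_free e.

Implicit Types (S F A R : {set T}) (u v w x y : T).

(** * Maximal dissociation sets and branching *)

Definition nbr S v := [set w in S | e v w].
Definition maximal_diss S :=
  [set F | maxset (fun B : {set T} => (B \subset S) && dissociation e B) F].
Definition phi S := #|maximal_diss S|.

Lemma in_nbr S v w : (w \in nbr S v) = (w \in S) && e v w.
Proof. by rewrite inE. Qed.

Lemma nbr_sub S v : nbr S v \subset S.
Proof. by apply/subsetP => w; rewrite inE => /andP[]. Qed.

Lemma nbrD S R v : nbr (S :\: R) v = nbr S v :\: R.
Proof. by apply/setP => w; rewrite !inE andbA. Qed.

Lemma nbr_self S v : v \notin nbr S v.
Proof. by rewrite inE irr_e andbF. Qed.

Lemma nbr_sym S u v : u \in S -> v \in nbr S u -> u \in nbr S v.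
Proof. by rewrite !inE sym_e => -> /andP[]. Qed.

Lemma nbr_disjoint S u v : e u v -> [disjoint nbr S u & nbr S v].
Proof.
move=> euv; apply/pred0P => w /=; rewrite !inE.
apply/negP => /andP[/andP[_ euw] /andP[_ evw]].
by have := tf_e u v w; rewrite euv evw euw.
Qed.

Lemma card_nbrU S u v : e u v -> #|nbr S u :|: nbr S v| = #|nbr S u| + #|nbr S v|.
Proof.
move/(nbr_disjoint S)=> d; apply/eqP.
by have [_ ->] := leq_card_setU (nbr S u) (nbr S v).
Qed.

Lemma maximalP S F : F \in maximal_diss S ->
  [/\ F \subset S, dissociation e F &
   forall B : {set T}, F \subset B -> B \subset S -> dissociation e B -> B = F].
Proof.
rewrite inE => /maxsetP[/andP[FS dF] maxF]; split=> // B FB BS dB.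
by apply: maxF; rewrite // BS.
Qed.

(** Adding u to F must break the dissociation property: either u acquires two neighbours, or a
    neighbour of u that already has a neighbour in F acquires a second one. *)
Lemma maximal_ext S F u : F \in maximal_diss S -> u \in S -> u \notin F ->
  (exists y z, [/\ y \in F, z \in F, e u y, e u z & y != z]) \/
  (exists y z, [/\ y \in F, z \in F, e u y & e y z]).
Proof.
case/maximalP=> FS dF maxF Su nFu.
case: (boolP [exists y in F, exists z in F, [&& e u y, e u z & y != z]]).
  by case/exists_inP=> y Fy /exists_inP[z Fz /and3P[]]; left; exists y, z.
move=> nI; case: (boolP [exists y in F, exists z in F, e u y && e y z]).
  by case/exists_inP=> y Fy /exists_inP[z Fz /andP[]]; right; exists y, z.
move=> nII; case/negP: nFu; rewrite -(maxF (u |: F)) ?setU11 ?subsetUr //.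
  by rewrite subUset sub1set Su.
apply/dissociationP => x y z.
have P1 a b : a \in F -> b \in F -> e u a -> e u b -> a = b.
  move=> Fa Fb ua ub; apply/eqP; apply: contraNT nI => ab.
  by apply/exists_inP; exists a => //; apply/exists_inP; exists b; rewrite // ua ub.
have P2 a b : a \in F -> b \in F -> e u a -> ~~ e a b.
  move=> Fa Fb ua; apply: contra nII => ab.
  by apply/exists_inP; exists a => //; apply/exists_inP; exists b; rewrite // ua ab.
rewrite !inE => /predU1P[->|Fx] /predU1P[->|Fy] /predU1P[->|Fz]; rewrite ?irr_e //.
- exact: P1.
- by rewrite (sym_e x u) => ux xz; have := P2 _ _ Fx Fz ux; rewrite xz.
- by rewrite (sym_e x u) => xy ux; have := P2 _ _ Fx Fy ux; rewrite xy.
- by move/dissociationP: dF; apply.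
Qed.

(* If R contains A and N(A), deleting R from a member of the family leaves a
   maximal dissociation set of G[S \ R], and this deletion is injective. *)
Definition trace_family S R A := [set F in maximal_diss S | F :&: R == A].

Lemma trace_family_le S R A :
  (forall a, a \in A -> nbr S a \subset R) ->
  #|trace_family S R A| <= phi (S :\: R).
Proof.
move=> nA; rewrite -(card_in_imset (f := fun F : {set T} => F :\: R)); last first.
  move=> F G; rewrite !inE => /andP[_ /eqP FA] /andP[_ /eqP GA] FG.
  by rewrite -(setID F R) -(setID G R) FG FA GA.
apply/subset_leq_card/subsetP => _ /imsetP[F /[1!inE] /andP[/maximalP[FS dF maxF] /eqP FA] ->].
rewrite inE; apply/maxsetP; split.
  rewrite setSD //=; apply/dissociationP => x y z.
  rewrite !inE => /andP[_ Fx] /andP[_ Fy] /andP[_ Fz].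
  by move/dissociationP: dF; apply.
move=> B /andP[BS dB] FB.
have nBR z : z \in B -> z \notin R by move/(subsetP BS); rewrite inE => /andP[].
have nAB a z : a \in A -> z \in B -> ~~ e a z.
  move=> Aa Bz; apply/negP => eaz.
  have /(subsetP (nA a Aa)) : z \in nbr S a.
    by rewrite inE eaz andbT; move/(subsetP BS): Bz; rewrite inE => /andP[].
  by rewrite (negPf (nBR z Bz)).
have AF a : a \in A -> a \in F by rewrite -FA inE => /andP[].
have AR a : a \in A -> a \in R by rewrite -FA inE => /andP[].
(* The neighbours of A in S lie in R and B avoids R, so no edge joins A to B. Thus A U B is a
   dissociation set containing F, and maximality of F applies. *)
have AB : A :|: B = F.
  apply: maxF.
  - by rewrite -{1}(setID F R) FA setUS.
  - rewrite subUset (subset_trans _ FS) ?(subset_trans BS) ?subsetDl //.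
    by apply/subsetP => a /AF.
  - apply/dissociationP => x y z; rewrite !inE => /orP[Ax|Bx] /orP[Ay|By] /orP[Az|Bz].
    + by move/dissociationP: dF; apply; apply: AF.
    + by rewrite (negPf (nAB x z _ _)).
    + by rewrite (negPf (nAB x y _ _)).
    + by rewrite (negPf (nAB x y _ _)).
    + by rewrite sym_e (negPf (nAB y x _ _)).
    + by rewrite sym_e (negPf (nAB y x _ _)).
    + by move=> _; rewrite sym_e (negPf (nAB z x _ _)).
    + by move/dissociationP: dB; apply.
rewrite -AB setDUl; apply/setP => z; rewrite !inE.
case: (boolP (z \in B)) => [/nBR -> //|_]; first by rewrite orbT.
by rewrite andbF orbF; case: (boolP (z \in A)) => [/AR -> //|_]; rewrite andbF.
Qed.

Definition isolated_in S v := trace_family S (v |: nbr S v) [set v].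
(** For an edge uv of G[S], N(u) U N(v) contains u and v themselves, so this trace says that both
    lie in F and that no other neighbour of either does. *)
Definition matched_in S u v := trace_family S (nbr S u :|: nbr S v) [set u; v].

Lemma isolated_in_le S v : #|isolated_in S v| <= phi (S :\: (v |: nbr S v)).
Proof. by apply: trace_family_le => a /set1P ->; apply: subsetUr. Qed.

Lemma matched_in_le S u v : #|matched_in S u v| <= phi (S :\: (nbr S u :|: nbr S v)).
Proof. by apply: trace_family_le => a /set2P[] ->; rewrite ?subsetUl ?subsetUr. Qed.

Lemma in_isolated S F v : F \in maximal_diss S -> v \in F ->
  (forall w, w \in F -> ~~ e v w) -> F \in isolated_in S v.
Proof.
move=> MF Fv nv; rewrite !inE in MF *; rewrite MF; apply/eqP/setP => w.
rewrite !inE; case: (eqVneq w v) => [-> //|_] /=; first by rewrite Fv.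
by case: (boolP (w \in F)) => //= /nv/negPf->; rewrite andbF.
Qed.

Lemma in_matched S F u v : F \in maximal_diss S -> u \in F -> v \in F -> e u v ->
  F \in matched_in S u v.
Proof.
move=> MF Fu Fv euv; case/maximalP: (MF) => FS /dissociationP dF _.
rewrite !inE in MF *; rewrite MF; apply/eqP/setP => w; rewrite !inE.
apply/idP/idP.
  case/andP=> Fw /orP[] /andP[Sw ew]; first by rewrite (dF u w v) ?eqxx ?orbT.
  by rewrite (dF v w u) ?eqxx // sym_e.
by case/orP=> /eqP ->; rewrite ?Fu ?Fv (subsetP FS) ?Fu ?Fv //= ?(sym_e v u) euv ?orbT.
Qed.

Lemma leq_card_bigcup (I : finType) (P : {set I}) (B : I -> {set {set T}}) (f : I -> nat) :
  (forall i, i \in P -> #|B i| <= f i) ->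
  #|\bigcup_(i in P) B i| <= \sum_(i in P) f i.
Proof.
move=> Bf; elim/big_rec2: _ => [|i m C Pi le_C]; first by rewrite cards0.
by apply: leq_trans (leq_card_setU _ _) _; rewrite leq_add ?Bf.
Qed.

Lemma matched_sum_le S v :
  #|\bigcup_(w in nbr S v) matched_in S v w|
    <= \sum_(w in nbr S v) phi (S :\: (nbr S v :|: nbr S w)).
Proof. by apply: leq_card_bigcup => w _; apply: matched_in_le. Qed.

Lemma in_matched_sum S F v w : F \in maximal_diss S -> v \in F -> w \in F -> e v w ->
  F \in \bigcup_(w in nbr S v) matched_in S v w.
Proof.
move=> MF Fv Fw evw; apply/bigcupP; exists w; last exact: in_matched.
by case/maximalP: MF => /subsetP FS _ _; rewrite inE FS.
Qed.

(* The set misses v, or v is isolated in it, or v is matched with a neighbour. *)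
Lemma phi_branch S v :
  phi S <= phi (S :\ v) + phi (S :\: (v |: nbr S v))
           + \sum_(w in nbr S v) phi (S :\: (nbr S v :|: nbr S w)).
Proof.
have out_le : #|trace_family S [set v] set0| <= phi (S :\ v).
  by apply: trace_family_le => a; rewrite inE.
apply: leq_trans _ (leq_add (leq_add out_le (isolated_in_le S v)) (matched_sum_le S v)).
apply: leq_trans _ (leq_add (leq_card_setU _ _) (leqnn _)).
apply: leq_trans _ (leq_card_setU _ _).
apply/subset_leq_card/subsetP => F MF; rewrite 2!in_setU -orbA.
case: (boolP (v \in F)) => Fv; last first.
  rewrite [F \in trace_family _ _ _]inE MF -[_ == set0]/(_ == _) setI_eq0 disjoint_sym.
  by rewrite disjoints1 Fv.
case: (boolP [exists w in F, e v w]) => [/exists_inP[w Fw vw]|].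
  by rewrite (in_matched_sum MF Fv Fw vw) !orbT.
rewrite negb_exists_in => /forall_inP nv.
by rewrite (in_isolated MF Fv nv) !orbT.
Qed.

(** By maximality, a vertex isolated in G[S] belongs to every member of the family. *)
Lemma phi_isolated S u : u \in S -> nbr S u = set0 -> phi S <= phi (S :\ u).
Proof.
move=> Su nu; have := isolated_in_le S u; rewrite nu setU0; apply: leq_trans.
apply/subset_leq_card/subsetP => F MF.
have [/subsetP FS _ _] := maximalP MF.
have nuF w : w \in F -> ~~ e u w.
  move=> Fw; apply/negP => uw.
  have : w \in nbr S u by rewrite inE FS.
  by rewrite nu inE.
apply: in_isolated => //; apply/negPn/negP => nFu.
case: (maximal_ext MF Su nFu) => [[y [z [Fy _ uy _ _]]]|[y [z [Fy _ uy _]]]];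
  by have := nuF _ Fy; rewrite uy.
Qed.

(** Unless x lies in F and has a neighbour there, nothing blocks the leaf u, so u is in F; it is
    isolated there, since its only possible partner is x. *)
Lemma phi_leaf S u x : u \in S -> nbr S u = [set x] ->
  phi S <= phi (S :\: [set u; x])
           + \sum_(w in nbr S x) phi (S :\: (nbr S x :|: nbr S w)).
Proof.
move=> Su nu; have := leq_add (isolated_in_le S u) (matched_sum_le S x).
rewrite nu; apply: leq_trans; apply: leq_trans _ (leq_card_setU _ _).
apply/subset_leq_card/subsetP => F MF; rewrite in_setU.
have [/subsetP FS _ _] := maximalP MF.
have nuF w : w \in F -> e u w -> w = x.
  by move=> Fw uw; apply/set1P; rewrite -nu inE FS.
case: (boolP [exists y in F, (y == x) && [exists z in F, e y z]]).
  case/exists_inP=> y Fy /andP[/eqP yx /exists_inP[z Fz]]; rewrite yx in Fy * => xz.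
  by rewrite (in_matched_sum MF Fy Fz xz) orbT.
move=> nx; have {}nx y z : y \in F -> z \in F -> e u y -> ~~ e y z.
  move=> Fy Fz uy; apply: contra nx => yz; apply/exists_inP; exists y => //.
  by rewrite (nuF y) // eqxx /= -(nuF y) //; apply/exists_inP; exists z.
have Fu : u \in F.
  apply/negPn/negP => nFu.
  case: (maximal_ext MF Su nFu) => [[y [z [Fy Fz uy uz]]]|[y [z [Fy Fz uy yz]]]].
    by rewrite (nuF y) // (nuF z) // eqxx.
  by have := nx y z Fy Fz uy; rewrite yz.
rewrite in_isolated // => w Fw; apply/negP => uw.
by have := nx w u Fw Fu uw; rewrite sym_e uw.
Qed.

(* By maximality, unless u is isolated in the set or a neighbour of u is matched,
   u is blocked by its two neighbours, both isolated in the set. *)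
Lemma phi_deg2 S u v x : u \in S -> v != x -> nbr S u = [set v; x] ->
  phi S <= phi (S :\: (u |: nbr S u))
           + \sum_(w in nbr S v) phi (S :\: (nbr S v :|: nbr S w))
           + \sum_(w in nbr S x) phi (S :\: (nbr S x :|: nbr S w))
           + phi (S :\: ([set v; x] :|: (nbr S v :|: nbr S x))).
Proof.
move=> Su vx nu.
have pair_le : #|trace_family S ([set v; x] :|: (nbr S v :|: nbr S x)) [set v; x]|
               <= phi (S :\: ([set v; x] :|: (nbr S v :|: nbr S x))).
  by apply: trace_family_le => a /set2P[] ->; rewrite setUA;
     [rewrite -setUA setUCA subsetUl | rewrite subsetUr].
apply: leq_trans _ (leq_add (leq_add (leq_add (isolated_in_le S u)
  (matched_sum_le S v)) (matched_sum_le S x)) pair_le).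
apply: leq_trans _ (leq_add (leq_add (leq_card_setU _ _) (leqnn _)) (leqnn _)).
apply: leq_trans _ (leq_add (leq_card_setU _ _) (leqnn _)).
apply: leq_trans _ (leq_card_setU _ _).
apply/subset_leq_card/subsetP => F MF; rewrite 3!in_setU.
have [/subsetP FS _ _] := maximalP MF.
have nuF w : w \in F -> e u w -> w = v \/ w = x.
  by move=> Fw uw; apply/set2P; rewrite -nu inE FS.
have [euv eux] : e u v /\ e u x.
  have : v \in nbr S u by rewrite nu set21.
  have : x \in nbr S u by rewrite nu set22.
  by rewrite !inE => /andP[_ ->] /andP[_ ->].
case: (boolP [exists y in F, e u y && [exists z in F, e y z]]).
  case/exists_inP=> y Fy /andP[/(nuF y Fy) vx' /exists_inP[z Fz]].
  by case: vx' => yE yz; rewrite yE in Fy yz; rewrite (in_matched_sum MF Fy Fz yz) ?orbT.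
move=> nx; have {}nx y z : y \in F -> z \in F -> e u y -> ~~ e y z.
  move=> Fy Fz uy; apply: contra nx => yz; apply/exists_inP; exists y => //.
  by rewrite uy; apply/exists_inP; exists z.
case: (boolP (u \in F)) => Fu.
  rewrite in_isolated // => w Fw; apply/negP => uw.
  by have := nx w u Fw Fu uw; rewrite sym_e uw.
case: (maximal_ext MF Su Fu) => [[y [z [Fy Fz uy uz yz]]]|[y [z [Fy Fz uy yz]]]]; last first.
  by have := nx y z Fy Fz uy; rewrite yz.
have [Fv Fx] : v \in F /\ x \in F.
  have [yE zE] := (nuF y Fy uy, nuF z Fz uz).
  by case: yE zE yz Fy Fz => -> [] ->; rewrite ?eqxx.
apply/orP; right; rewrite inE MF; apply/eqP/setP => w; rewrite !inE.
case: (boolP (w \in F)) => [Fw|nFw] /=.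
  by rewrite (negPf (nx v w _ _ _)) // (negPf (nx x w _ _ _)) // !andbF !orbF.
by apply/esym/negbTE; apply: contra nFw => /orP[] /eqP ->.
Qed.


(** Neighbourhoods are taken in all of S, so the 4-cycle u v w x is an entire component of G[S]. *)
Inductive C4_union : {set T} -> Prop :=
| C4_union0 : C4_union set0
| C4_unionU S u v w x :
    [/\ u \in S, v \in S, w \in S & x \in S] ->
    v != x -> u != w ->
    nbr S u = [set v; x] -> nbr S v = [set u; w] ->
    nbr S w = [set v; x] -> nbr S x = [set u; w] ->
    C4_union (S :\: ([set v; x] :|: [set u; w])) ->
    C4_union S.

(** * Weights *)

Variables (R : realFieldType) (t : R).
Hypotheses (t_gt0 : (0 < t)%R) (t4 : (6 * t ^+ 4 = 1)%R).

Local Open Scope ring_scope.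

(** The exponent is |S| and not |S'|: a branching inequality for [phi] then turns into an inequality
    between terms on the common scale t^|S|. *)
Definition weight S' S : R := (phi S')%:R * t ^+ #|S|.
Definition rho S : R := weight S S.

(** Rational bounds slightly above t, t^2 and t^3. Higher powers reduce to these through t^4 = 1/6,
    which makes the later estimates linear and accessible to [lra]. *)
Lemma t_bounds : [/\ t <= 639 / 1000, t ^+ 2 <= 49 / 120,
  t ^+ 3 <= 261 / 1000 & t ^+ 4 = 1 / 6] /\
  [/\ t ^+ 5 = t / 6, t ^+ 6 = t ^+ 2 / 6 & t ^+ 7 = t ^+ 3 / 6].
Proof.
have e4 : t ^+ 4 = 1 / 6 by move: t4; lra.
have b2 : t ^+ 2 <= 49 / 120.
  rewrite -(@ler_pXn2r _ 2) ?nnegrE ?exprn_ge0 ?ltW //; last by lra.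
  by rewrite -exprM e4 expr2; lra.
have b1 : t <= 639 / 1000.
  rewrite -(@ler_pXn2r _ 4) ?nnegrE ?(ltW t_gt0) ?e4 //; last by lra.
  by rewrite (exprM _ 2 2) !expr2; lra.
have b3 : t ^+ 3 <= 261 / 1000.
  have : t ^+ 3 <= 639 / 1000 * (49 / 120).
    by rewrite exprS ler_pM ?exprn_ge0 // ltW.
  by lra.
split; split=> //.
- by rewrite (exprD t 1 4) e4 expr1; lra.
- by rewrite (exprD t 2 4) e4; lra.
- by rewrite (exprD t 3 4) e4; lra.
Qed.

Lemma t_lt1 : t < 1.
Proof. by have [[? _ _ _] _] := t_bounds; lra. Qed.

Lemma tX_le k m : (k <= m)%N -> t ^+ m <= t ^+ k.
Proof. by move=> km; rewrite ler_wiXn2l // ltW // t_lt1. Qed.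

Lemma tX_ge0 k : 0 <= t ^+ k. Proof. by rewrite exprn_ge0 ?ltW. Qed.

Lemma weight_ge0 S' S : 0 <= weight S' S.
Proof. by rewrite mulr_ge0 ?ler0n ?tX_ge0. Qed.

Lemma weight_le S' S k q : 0 <= q -> (#|S'| + k <= #|S|)%N -> rho S' <= q ->
  weight S' S <= q * t ^+ k.
Proof.
move=> q0 le_k le_q; rewrite /weight; have -> : #|S| = (#|S'| + (#|S| - #|S'|))%N by lia.
have kS : (k <= #|S| - #|S'|)%N by lia.
by rewrite exprD mulrA; apply: ler_pM (tX_le kS); rewrite ?tX_ge0 ?weight_ge0.
Qed.

Definition rho_le1_below S := forall S', (#|S'| < #|S|)%N -> rho S' <= 1.

Lemma card_setD_add (S R' : {set T}) k : R' \subset S -> (k <= #|R'|)%N ->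
  (#|S :\: R'| + k <= #|S|)%N.
Proof. by move=> RS kR; rewrite cardsD (setIidPr RS); have := subset_leq_card RS; lia. Qed.

(** Positivity of k makes S \ R' strictly smaller than S, so the induction hypothesis bounds its
    [rho] by 1; the deleted vertices account for the factor t^k. *)
Lemma weightD_le S (R' : {set T}) k : rho_le1_below S -> R' \subset S ->
  (0 < k <= #|R'|)%N -> weight (S :\: R') S <= t ^+ k.
Proof.
move=> IH RS /andP[k0 kR]; rewrite -[t ^+ k]mul1r; apply: weight_le => //.
  exact: card_setD_add.
by apply: IH; have := card_setD_add RS kR; lia.
Qed.

Definition deg S v := #|nbr S v|.

Lemma deg_gt0 S v w : w \in nbr S v -> (0 < deg S v)%N.
Proof. by move=> vw; apply/card_gt0P; exists w. Qed.

Lemma card_closed_nbr S v : #|v |: nbr S v| = (deg S v).+1.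
Proof. by rewrite cardsU1 nbr_self. Qed.

Lemma closed_nbr_sub S v : v \in S -> v |: nbr S v \subset S.
Proof. by move=> Sv; rewrite subUset sub1set Sv nbr_sub. Qed.

Lemma weight_closed_le S v k : rho_le1_below S -> v \in S -> (k = (deg S v).+1)%N ->
  weight (S :\: (v |: nbr S v)) S <= t ^+ k.
Proof.
by move=> IH Sv ->; apply: weightD_le; rewrite ?closed_nbr_sub ?card_closed_nbr /=.
Qed.

Lemma weight_edge_le S v w k : rho_le1_below S -> v \in S -> w \in nbr S v ->
  (0 < k <= deg S v + deg S w)%N ->
  weight (S :\: (nbr S v :|: nbr S w)) S <= t ^+ k.
Proof.
rewrite in_nbr => IH Sv /andP[Sw vw] kd; apply: weightD_le => //.
  by rewrite subUset !nbr_sub.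
by rewrite card_nbrU.
Qed.

Lemma sum_le_const (A : {set T}) (f : T -> R) q :
  (forall w, w \in A -> f w <= q) -> \sum_(w in A) f w <= #|A|%:R * q.
Proof. by move=> fq; apply: le_trans (ler_sum _ fq) _; rewrite sumr_const mulr_natl. Qed.

Lemma sum_le_const1 (A : {set T}) (f : T -> R) u q p : u \in A -> f u <= p ->
  (forall w, w \in A -> w != u -> f w <= q) ->
  \sum_(w in A) f w <= p + (#|A|.-1)%:R * q.
Proof.
move=> Au fu fq; rewrite (big_setD1 u) //= lerD //.
have -> : #|A|.-1 = #|A :\ u| by rewrite (cardsD1 u A) Au.
by apply: sum_le_const => w /setD1P[wu Aw]; apply: fq.
Qed.

Lemma rho_branch S v : rho S <= weight (S :\ v) S + weight (S :\: (v |: nbr S v)) S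
  + \sum_(w in nbr S v) weight (S :\: (nbr S v :|: nbr S w)) S.
Proof.
by rewrite -mulr_suml -!mulrDl -natr_sum -!natrD ler_wpM2r ?tX_ge0 ?ler_nat // phi_branch.
Qed.

Lemma rho_leaf S u x : u \in S -> nbr S u = [set x] -> rho S <= weight (S :\: [set u; x]) S
  + \sum_(w in nbr S x) weight (S :\: (nbr S x :|: nbr S w)) S.
Proof.
move=> Su nu.
by rewrite -mulr_suml -!mulrDl -natr_sum -!natrD ler_wpM2r ?tX_ge0 ?ler_nat // phi_leaf.
Qed.

Lemma rho_deg2 S u v x : u \in S -> v != x -> nbr S u = [set v; x] ->
  rho S <= weight (S :\: (u |: nbr S u)) S
  + \sum_(w in nbr S v) weight (S :\: (nbr S v :|: nbr S w)) S
  + \sum_(w in nbr S x) weight (S :\: (nbr S x :|: nbr S w)) S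
  + weight (S :\: ([set v; x] :|: (nbr S v :|: nbr S x))) S.
Proof.
move=> Su vx nu.
by rewrite -!mulr_suml -!mulrDl -!natr_sum -!natrD ler_wpM2r ?tX_ge0 ?ler_nat // phi_deg2.
Qed.

(** The expression peaks at D = 2 with value 2 t^3. From there on, the next value is t times the sum
    of the current one and a power of t with exponent at least 3, which stays below the bound. *)
Lemma leaf_numeric D : (0 < D)%N -> D%:R * t ^+ D.+1 <= 522 / 1000.
Proof.
have [[b1 b2 b3 _] _] := t_bounds.
case: D => // D _; elim: D => [|D IHD]; first by rewrite mul1r; lra.
case: D IHD => [_|D IHD]; first by lra.
have b : t ^+ D.+3 <= t ^+ 3 by apply: tX_le.
rewrite [D.+3%:R]mulrS exprS mulrCA.
have : t * ((1 + D.+2%:R) * t ^+ D.+3) <= 639 / 1000 * (261 / 1000 + 522 / 1000).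
  apply: ler_pM => //; first exact: ltW.
  - by rewrite mulr_ge0 ?tX_ge0 // addr_ge0.
  - by rewrite mulrDl mul1r lerD //; apply: le_trans b3.
by lra.
Qed.

(** At D = 5 the value is t^6 + 5 t^7 < 29/100; the value at D + 1 is t times the sum of the value
    at D and t^(D+2). *)
Lemma branch_numeric D : (5 <= D)%N -> t ^+ D.+1 + D%:R * t ^+ D.+2 <= 29 / 100.
Proof.
have [[b1 b2 b3 _] [b5 b6 b7]] := t_bounds.
elim: D => // D IHD; rewrite leq_eqVlt => /orP[/eqP <-|]; first by lra.
rewrite ltnS => D5; have b : t ^+ D.+2 <= t ^+ 7 by apply: tX_le.
have : t * (t ^+ D.+1 + D.+1%:R * t ^+ D.+2) <= 639 / 1000 * (29 / 100 + t ^+ 7).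
  apply: ler_pM => //; first exact: ltW.
    by rewrite addr_ge0 ?tX_ge0 // mulr_ge0 ?tX_ge0 ?ler0n.
  by rewrite mulrSr mulrDl mul1r addrA lerD // IHD.
by rewrite mulrDr mulrCA -!exprS; lra.
Qed.

(** * Numerical case analysis *)

Lemma rho_deg_le1 S u : rho_le1_below S -> u \in S -> (deg S u <= 1)%N ->
  rho S <= 931 / 1000.
Proof.
move=> IH Su; have [[b1 b2 _ _] _] := t_bounds.
rewrite leq_eqVlt ltnS leqn0 => /orP[/cards1P[x nu]|]; last first.
  rewrite cards_eq0 => /eqP nu.
  have : rho S <= weight (S :\ u) S.
    by rewrite ler_wpM2r ?tX_ge0 // ler_nat phi_isolated.
  have : weight (S :\ u) S <= t ^+ 1 by apply: weightD_le; rewrite ?sub1set ?cards1.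
  by rewrite expr1; lra.
have : x \in nbr S u by rewrite nu set11.
move=> ux; have xu := nbr_sym Su ux.
have Sx : x \in S by move: ux; rewrite inE => /andP[].
have ux' : u != x by apply: contraTneq ux => ->; rewrite nbr_self.
have w1 : weight (S :\: [set u; x]) S <= t ^+ 2.
  by apply: weightD_le; rewrite ?cards2 ?ux' // subUset !sub1set Su.
have : \sum_(w in nbr S x) weight (S :\: (nbr S x :|: nbr S w)) S
       <= (deg S x)%:R * t ^+ (deg S x).+1.
  apply: sum_le_const => w xw; apply: weight_edge_le => //.
  have Sw : w \in S by move: xw; rewrite inE => /andP[].
  by rewrite -[(deg S x).+1]addn1 leq_add2l (deg_gt0 (nbr_sym Sx xw)) addn1.
(* The two contributions add up to at most 49/120 + 522/1000 < 931/1000. *)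
have := leaf_numeric (deg_gt0 xu).
by have := rho_leaf Su nu; lra.
Qed.

Lemma card2_rem (A : {set T}) v : v \in A -> #|A| = 2%N ->
  exists2 x, v != x & A = [set v; x].
Proof.
move=> Av A2; have /cards1P[x Ax] : #|A :\ v| == 1%N.
  by move: A2; rewrite (cardsD1 v) Av add1n => -[->].
exists x; last by rewrite -Ax setD1K.
by have : x \in A :\ v; [rewrite Ax set11 | rewrite !inE eq_sym => /andP[]].
Qed.

Lemma nbr_nadj S u v x : nbr S u = [set v; x] -> x \notin nbr S v.
Proof.
move=> nu; have uv : v \in nbr S u by rewrite nu set21.
have ux : x \in nbr S u by rewrite nu set22.
move: uv ux; rewrite !inE => /andP[_ uv] /andP[_ ux].
by apply/negP => /andP[_ vx]; have := tf_e u v x; rewrite uv vx ux.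
Qed.

Lemma weight_pair_le S u v x k : rho_le1_below S -> v != x -> u \in S ->
  nbr S u = [set v; x] -> (0 < k <= 2 + #|nbr S v :|: nbr S x|)%N ->
  weight (S :\: ([set v; x] :|: (nbr S v :|: nbr S x))) S <= t ^+ k.
Proof.
move=> IH vx Su nu kP; have := nbr_nadj nu.
have /nbr_nadj nvx : nbr S u = [set x; v] by rewrite setUC.
move=> nxv.
apply: weightD_le => //; first by rewrite -nu !subUset !nbr_sub.
rewrite -setUA cardsU1 cardsU1 !inE (negPf vx) /=.
by rewrite -!in_nbr (negPf nvx) (negPf nxv) (negPf (nbr_self _ _)) (negPf (nbr_self _ _)).
Qed.

(* A second common neighbour y of v and x makes the last term larger, but then
   either y has degree 3, or y is isolated once N[u] is removed. *)
Lemma rho_deg2_deg3 S u v : rho_le1_below S ->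
  (forall w, w \in S -> (2 <= deg S w <= 3)%N) ->
  u \in S -> deg S u = 2%N -> v \in nbr S u -> deg S v = 3%N -> rho S <= 983 / 1000.
Proof.
move=> IH degS Su du uv dv; have [[b1 b2 b3 b4] [b5 b6 b7]] := t_bounds.
have [x vx nu] := card2_rem uv du.
have ux : x \in nbr S u by rewrite nu set22.
have nS w z : z \in nbr S w -> z \in S by rewrite in_nbr => /andP[].
have [Sv Sx] := (nS _ _ uv, nS _ _ ux).
have deg2 w z : z \in nbr S w -> (2 <= deg S z)%N by move/nS/degS => /andP[].
have edge y z k m : y \in S -> z \in nbr S y -> (m <= deg S z)%N ->
    (k = deg S y + m)%N -> (0 < k)%N -> weight (S :\: (nbr S y :|: nbr S z)) S <= t ^+ k.
  by move=> Sy yz dz -> k0; rewrite weight_edge_le // k0 leq_add2l.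
have iso : weight (S :\: (u |: nbr S u)) S <= t ^+ 3 by apply: weight_closed_le; rewrite ?du.
have sumv : \sum_(w in nbr S v) weight (S :\: (nbr S v :|: nbr S w)) S <= 3 * t ^+ 5.
  rewrite -[3%N]dv; apply: sum_le_const => w vw.
  by apply: (edge _ _ _ 2%N); rewrite ?dv ?(deg2 v).
have sumx : \sum_(w in nbr S x) weight (S :\: (nbr S x :|: nbr S w)) S
            <= (deg S x)%:R * t ^+ (deg S x + 2).
  apply: sum_le_const => w xw.
  by apply: (edge _ _ _ 2%N); rewrite ?(deg2 x) ?addn2.
have := rho_deg2 Su vx nu.
case: (boolP [exists y, [&& y != u, y \in nbr S v & y \in nbr S x]]).
  case/existsP=> y /and3P[yu vy xy].
  have Sy := nS _ _ vy.
  (* Only N(v) is counted: together with v and x it already gives 3 + 2 vertices. *)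
  have pair : weight (S :\: ([set v; x] :|: (nbr S v :|: nbr S x))) S <= t ^+ 5.
    apply: weight_pair_le nu _ => //.
    by apply: (@leq_add 2 3) => //; rewrite -dv; exact/subset_leq_card/subsetUl.
  have : deg S y = 2%N \/ deg S y = 3%N.
    by case/andP: (degS y Sy); case: (deg S y) => [|[|[|[|]]]]; auto.
  case=> dy.
    have ny : nbr S y = [set v; x].
      apply/esym/eqP; rewrite eqEcard subUset !sub1set !(nbr_sym _ vy) ?(nbr_sym _ xy) //=.
      by rewrite cards2 vx -/(deg S y) dy.
    have {}iso : weight (S :\: (u |: nbr S u)) S <= t ^+ 4.
      have nuy : y \notin u |: nbr S u.
        rewrite nu !inE (negPf yu) /=; apply/norP; split.
          by apply: contraTneq vy => ->; rewrite nbr_self.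
        by apply: contraTneq xy => ->; rewrite nbr_self.
      apply: (@le_trans _ _ (weight (S :\: (y |: (u |: nbr S u))) S)).
        rewrite ler_wpM2r ?tX_ge0 // ler_nat [y |: _]setUC.
        rewrite -[S :\: (_ :|: [set y])]setDDl.
        apply: (@phi_isolated (S :\: (u |: nbr S u)) y); first by rewrite inE nuy.
        by apply/eqP; rewrite nbrD ny nu setD_eq0 subsetUr.
      apply: weightD_le => //; first by rewrite subUset sub1set Sy closed_nbr_sub.
      by rewrite cardsU1 nuy card_closed_nbr du.
    have : deg S x = 2%N \/ deg S x = 3%N.
      by case/andP: (degS x Sx); case: (deg S x) => [|[|[|[|]]]]; auto.
    by case=> dx; rewrite dx in sumx; lra.
  have {}sumv : \sum_(w in nbr S v) weight (S :\: (nbr S v :|: nbr S w)) S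
                <= t ^+ 6 + 2 * t ^+ 5.
    rewrite -[2%N]/(3.-1)%N -dv; apply: (sum_le_const1 vy) => [|w vw _].
      by apply: (edge _ _ _ 3%N); rewrite ?dv ?dy.
    by apply: (edge _ _ _ 2%N); rewrite ?dv ?(deg2 v).
  have {}sumx : \sum_(w in nbr S x) weight (S :\: (nbr S x :|: nbr S w)) S
                <= t ^+ (deg S x + 3) + (deg S x).-1%:R * t ^+ (deg S x + 2).
    apply: (sum_le_const1 xy) => [|w xw _].
      by apply: (edge _ _ _ 3%N); rewrite ?dy ?addn3.
    by apply: (edge _ _ _ 2%N); rewrite ?(deg2 x) ?addn2.
  have : deg S x = 2%N \/ deg S x = 3%N.
    by case/andP: (degS x Sx); case: (deg S x) => [|[|[|[|]]]]; auto.
  by case=> dx; rewrite dx /= in sumx; lra.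
move=> noy.
(* Now u is the only common neighbour of v and x, so N(v) U N(x) has 3 + deg x - 1 elements. *)
have pair : weight (S :\: ([set v; x] :|: (nbr S v :|: nbr S x))) S <= t ^+ (4 + deg S x).
  apply: weight_pair_le nu _ => //.
  have -> : #|nbr S v :|: nbr S x| = (2 + deg S x)%N; last by rewrite addnA leqnn.
  rewrite cardsU -/(deg S v) -/(deg S x) dv.
  have -> : nbr S v :&: nbr S x = [set u].
    apply/setP => y; rewrite in_setI in_set1; apply/idP/eqP => [/andP[vy xy]|->].
      by apply: contraNeq noy => yu; apply/existsP; exists y; rewrite yu vy.
    by rewrite !(nbr_sym Su).
  by rewrite cards1 -addnBAC.
have : deg S x = 2%N \/ deg S x = 3%N.
  by case/andP: (degS x Sx); case: (deg S x) => [|[|[|[|]]]]; auto.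
(* The tightest case of all is deg x = 2 here: t^3 + 3 t^5 + 2 t^4 + t^6 < 983/1000. *)
by case=> dx; rewrite dx in sumx pair; lra.
Qed.

Lemma weight_del_le S v q : rho (S :\ v) <= q -> v \in S -> weight (S :\ v) S <= q * t.
Proof.
move=> le_q Sv; rewrite -[t]expr1; apply: weight_le => //.
  by apply: le_trans le_q; apply: weight_ge0.
by rewrite [#|S|](cardsD1 v) Sv addn1.
Qed.

Lemma rho_le1_belowW S S' : (#|S'| <= #|S|)%N -> rho_le1_below S -> rho_le1_below S'.
Proof. by move=> le_S IH Q ltQ; apply: IH; apply: leq_trans ltQ le_S. Qed.

Lemma rho_del_le1 S v : rho_le1_below S -> v \in S -> rho (S :\ v) <= 1.
Proof. by move=> IH Sv; apply: IH; rewrite [X in (_ < X)%N](cardsD1 v) Sv. Qed.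

Lemma degD1 S v u : v \in nbr S u -> deg S u = (deg (S :\ v) u).+1.
Proof. by move=> uv; rewrite /deg (cardsD1 v) uv nbrD. Qed.

Lemma rho_deg_ge5 S v : rho_le1_below S -> (forall w, w \in S -> (2 <= deg S w)%N) ->
  v \in S -> (5 <= deg S v)%N -> rho S <= 93 / 100.
Proof.
move=> IH degS Sv dv; have [[b1 _ _ _] _] := t_bounds.
have out := weight_del_le (rho_del_le1 IH Sv) Sv; rewrite mul1r in out.
have iso := weight_closed_le IH Sv erefl.
have : \sum_(w in nbr S v) weight (S :\: (nbr S v :|: nbr S w)) S
       <= (deg S v)%:R * t ^+ (deg S v).+2.
  apply: sum_le_const => w vw; apply: weight_edge_le => //.
  have Sw : w \in S by move: vw; rewrite in_nbr => /andP[].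
  by rewrite -addn2 leq_add2l degS ?addn2.
by have := branch_numeric dv; have := rho_branch S v; lra.
Qed.

(** The crude bound t + t^5 + 4 t^6 exceeds 1. Either a neighbour of degree at least 3 improves one
    matched term, or all neighbours have degree 2 and deleting v leaves a vertex of degree 1, which
    improves the first term. *)
Lemma rho_deg4 S v : rho_le1_below S -> (forall w, w \in S -> (2 <= deg S w)%N) ->
  v \in S -> deg S v = 4%N -> rho S <= 995 / 1000.
Proof.
move=> IH degS Sv dv; have [[b1 b2 b3 b4] [b5 b6 b7]] := t_bounds.
have iso : weight (S :\: (v |: nbr S v)) S <= t ^+ 5.
  by apply: weight_closed_le; rewrite ?dv.
have edge w k m : w \in nbr S v -> (m <= deg S w)%N -> (k = 4 + m)%N ->
    weight (S :\: (nbr S v :|: nbr S w)) S <= t ^+ k.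
  by move=> vw mw ->; rewrite weight_edge_le // dv leq_add2l.
have nS w : w \in nbr S v -> w \in S by rewrite in_nbr => /andP[].
have := rho_branch S v.
case: (boolP [exists w in nbr S v, 3 <= deg S w]%N) => [/exists_inP[w vw dw]|].
  have out := weight_del_le (rho_del_le1 IH Sv) Sv; rewrite mul1r in out.
  have : \sum_(w in nbr S v) weight (S :\: (nbr S v :|: nbr S w)) S
         <= t ^+ 7 + 3 * t ^+ 6.
    rewrite -[3%N]/(4.-1)%N -dv; apply: (sum_le_const1 vw) => [|z vz _].
      by apply: (edge _ _ 3%N); rewrite ?dv.
    by apply: (edge _ _ 2%N); rewrite ?degS ?nS ?dv.
  by lra.
rewrite negb_exists_in => /forall_inP deg2.
have : \sum_(w in nbr S v) weight (S :\: (nbr S v :|: nbr S w)) S <= 4 * t ^+ 6.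
  rewrite -[4%N]dv; apply: sum_le_const => z vz.
  by apply: (edge _ _ 2%N); rewrite ?degS ?nS ?dv.
have [u vu] : exists u, u \in nbr S v by apply/card_gt0P; rewrite -/(deg S v) dv.
have out : weight (S :\ v) S <= 931 / 1000 * t.
  apply: weight_del_le => //; apply: (@rho_deg_le1 _ u).
  - by apply: rho_le1_belowW IH; rewrite subset_leq_card ?subD1set.
  - rewrite !inE nS // andbT; apply: contraTneq vu => ->; exact: nbr_self.
  - by move: (deg2 u vu); rewrite (degD1 (nbr_sym Sv vu)) -ltnNge.
by lra.
Qed.

(** The crude bound t + t^4 + 3 t^6 slightly exceeds 1. After deleting v, its neighbour u has degree
    2, while another neighbour y of u is not adjacent to v, by triangle-freeness, and keeps degree
    3; so [rho_deg2_deg3] improves the first term. *)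
Lemma rho_cubic S v : rho_le1_below S -> (forall w, w \in S -> deg S w = 3%N) ->
  v \in S -> rho S < 1.
Proof.
move=> IH degS Sv; have [[b1 b2 b3 b4] [b5 b6 b7]] := t_bounds.
have dv := degS v Sv.
have nS w z : z \in nbr S w -> z \in S by rewrite in_nbr => /andP[].
have iso : weight (S :\: (v |: nbr S v)) S <= t ^+ 4.
  by apply: weight_closed_le; rewrite ?dv.
have sum_le : \sum_(w in nbr S v) weight (S :\: (nbr S v :|: nbr S w)) S <= 3 * t ^+ 6.
  rewrite -[3%N]dv; apply: sum_le_const => z vz.
  by apply: weight_edge_le; rewrite // dv (degS z) ?(nS v).
have [u vu] : exists u, u \in nbr S v by apply/card_gt0P; rewrite -/(deg S v) dv.
have uv := nbr_sym Sv vu.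
have Su := nS _ _ vu.
have du : deg (S :\ v) u = 2%N by apply: succn_inj; rewrite -degD1 // degS.
have degW w : w \in S -> v \notin nbr S w -> deg (S :\ v) w = 3%N.
  move=> Sw vw; rewrite -(degS w Sw) /deg nbrD; congr #|pred_of_set _|.
  by apply/setDidPl; rewrite disjoint_sym disjoints1.
have [y uy] : exists y, y \in nbr (S :\ v) u.
  by apply/card_gt0P; rewrite -/(deg (S :\ v) u) du.
have out : weight (S :\ v) S <= 983 / 1000 * t.
  apply: weight_del_le => //; apply: (@rho_deg2_deg3 _ u y) => //.
  - by apply: rho_le1_belowW IH; rewrite subset_leq_card ?subD1set.
  - move=> w /setD1P[wv Sw]; case: (boolP (v \in nbr S w)) => [wv'|/degW-> //].
    by have := degS w Sw; rewrite (degD1 wv') => -[->].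
  - by rewrite !inE Su andbT; apply: contraTneq vu => ->; exact: nbr_self.
  - move: uy; rewrite nbrD => /setDP[uy _].
    apply: degW (nS _ _ uy) _; rewrite (disjointFr (nbr_disjoint S (_ : e u y)) uv) //.
    by move: uy; rewrite in_nbr => /andP[].
by have := rho_branch S v; lra.
Qed.

(* In a longer cycle, removing a path leaves a vertex of degree at most 1, which
   saves the factor of [rho_deg_le1]. *)
Lemma rho_2regular S u : rho_le1_below S -> u \in S -> deg S u = 2%N ->
  (forall w z, w \in S -> deg S w = 2%N -> z \in nbr S w -> deg S z = 2%N) ->
  (exists v w x, [/\ [/\ v \in S, w \in S, x \in S, v != x & u != w],
     nbr S u = [set v; x], nbr S v = [set u; w],
     nbr S w = [set v; x] & nbr S x = [set u; w]])
  \/ rho S <= 995 / 1000.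
Proof.
move=> IH Su du deg2; have [[b1 b2 b3 b4] [b5 b6 b7]] := t_bounds.
have nS w z : z \in nbr S w -> z \in S by rewrite in_nbr => /andP[].
have /card_gt0P[v uv] : (0 < #|nbr S u|)%N by rewrite -/(deg S u) du.
have [x vx nu] := card2_rem uv du.
have ux : x \in nbr S u by rewrite nu set22.
have [Sv Sx] := (nS _ _ uv, nS _ _ ux).
have dv := deg2 _ _ Su du uv; have dx := deg2 _ _ Su du ux.
have [w uw nv] := card2_rem (nbr_sym Su uv) dv.
have [z uz nx] := card2_rem (nbr_sym Su ux) dx.
have vw : w \in nbr S v by rewrite nv set22.
have xz : z \in nbr S x by rewrite nx set22.
have [Sw Sz] := (nS _ _ vw, nS _ _ xz).
have dw := deg2 _ _ Sv dv vw; have dz := deg2 _ _ Sx dx xz.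
(* Here w and z are the next vertices after v and x on the cycle through u; they coincide exactly
   when that cycle is a C_4. *)
case: (eqVneq w z) => [wz|wz].
  left; exists v, w, x; rewrite -wz in xz nx; split=> //.
  apply/esym/eqP; rewrite eqEcard subUset !sub1set (nbr_sym Sv) // (nbr_sym Sx) //=.
  by rewrite cards2 vx -/(deg S w) dw.
have euv : e u v by move: uv; rewrite in_nbr => /andP[].
have eux : e u x by move: ux; rewrite in_nbr => /andP[].
have wNu : w \notin nbr S u by rewrite (disjointFl (nbr_disjoint S euv) vw).
have zNu : z \notin nbr S u by rewrite (disjointFl (nbr_disjoint S eux) xz).
(* The vertex p has degree 2 and loses its neighbour q, so [rho_deg_le1] applies to S \ Q. *)
have cut (Q : {set T}) k p q : Q \subset S -> (0 < k <= #|Q|)%N -> p \in S -> p \notin Q ->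
    deg S p = 2%N -> q \in Q -> q \in nbr S p -> weight (S :\: Q) S <= 931 / 1000 * t ^+ k.
  move=> QS /andP[k0 kQ] Sp Qp dp Qq pq.
  have kD := card_setD_add QS kQ.
  apply: weight_le => //; first by lra.
  apply: (@rho_deg_le1 _ p).
  - by apply: rho_le1_belowW IH; apply: leq_trans kD; apply: leq_addr.
  - by rewrite inE Qp.
  - rewrite -ltnS -[in X in (_ <= X)%N]dp; apply: proper_card.
    rewrite properE nbrD subsetDl; apply/subsetPn; exists q => //.
    by rewrite inE Qq.
have iso : weight (S :\: (u |: nbr S u)) S <= 931 / 1000 * t ^+ 3.
  apply: (cut _ _ w v) => //; rewrite ?closed_nbr_sub ?card_closed_nbr ?du //.
  - by rewrite in_setU1 negb_or wNu andbT eq_sym.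
  - by rewrite in_setU1 uv orbT.
  - exact: nbr_sym.
have edge_vu : weight (S :\: (nbr S v :|: nbr S u)) S <= 931 / 1000 * t ^+ 4.
  apply: (cut _ _ z x) => //; rewrite ?subUset ?nbr_sub //.
  - by rewrite card_nbrU 1?sym_e // -/(deg S u) -/(deg S v) du dv.
  - by rewrite in_setU negb_or zNu nv !inE negb_or ![z == _]eq_sym uz wz.
  - by rewrite in_setU ux orbT.
  - exact: nbr_sym.
have edge_xu : weight (S :\: (nbr S x :|: nbr S u)) S <= 931 / 1000 * t ^+ 4.
  apply: (cut _ _ w v) => //; rewrite ?subUset ?nbr_sub //.
  - by rewrite card_nbrU 1?sym_e // -/(deg S u) -/(deg S x) du dx.
  - by rewrite in_setU negb_or wNu nx !inE negb_or [w == u]eq_sym uw wz.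
  - by rewrite in_setU uv orbT.
  - exact: nbr_sym.
have edge_vw : weight (S :\: (nbr S v :|: nbr S w)) S <= t ^+ 4.
  by apply: weight_edge_le; rewrite // dv dw.
have edge_xz : weight (S :\: (nbr S x :|: nbr S z)) S <= t ^+ 4.
  by apply: weight_edge_le; rewrite // dx dz.
have pair : weight (S :\: ([set v; x] :|: (nbr S v :|: nbr S x))) S <= t ^+ 5.
  apply: weight_pair_le nu _ => //; apply: (@leq_add 2 3) => //.
  apply: (@leq_trans #|z |: [set u; w]|).
    by rewrite cardsU1 cards2 uw !inE negb_or ![z == _]eq_sym uz wz.
  by rewrite nv nx; apply/subset_leq_card/subsetP => y; rewrite !inE => /or3P[] ->; rewrite ?orbT.
(* Three of the six terms carry the saved factor; the total is at most 931/1000 (t^3 + 2 t^4) + 2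
   t^4 + t^5 < 995/1000. *)
right; have := rho_deg2 Su vx nu.
have -> (f : T -> R) : \sum_(y in nbr S v) f y = f u + f w.
  by rewrite nv big_setU1 ?big_set1 // inE.
have -> (f : T -> R) : \sum_(y in nbr S x) f y = f u + f z.
  by rewrite nx big_setU1 ?big_set1 // inE.
by lra.
Qed.

(** [phi_deg2] yields six terms. Five of them delete exactly the cycle; the remaining one deletes
    N[u], after which w is isolated and can be deleted as well. *)
Lemma phi_C4 S u v w x :
  [/\ u \in S, v \in S, w \in S & x \in S] -> v != x -> u != w ->
  nbr S u = [set v; x] -> nbr S v = [set u; w] ->
  nbr S w = [set v; x] -> nbr S x = [set u; w] ->
  (phi S <= 6 * phi (S :\: ([set v; x] :|: [set u; w])))%N.
Proof.
case=> Su Sv Sw Sx vx uw nu nv nw nx.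
have nuw : w \notin nbr S u.
  by rewrite nu -nw nbr_self.
have iso : (phi (S :\: (u |: nbr S u)) <= phi (S :\: ([set v; x] :|: [set u; w])))%N.
  have -> : S :\: ([set v; x] :|: [set u; w]) = (S :\: (u |: nbr S u)) :\ w.
    rewrite setDDl nu; congr (_ :\: _); apply/setP => y; rewrite !inE.
    by case: (y == u); case: (y == v); case: (y == x); case: (y == w).
  apply: phi_isolated.
    by rewrite in_setD Sw andbT in_setU1 negb_or nuw eq_sym uw.
  by apply/eqP; rewrite nbrD nw nu setD_eq0 subsetUr.
apply: leq_trans (phi_deg2 Su vx nu) _.
have -> (f : T -> nat) : (\sum_(y in nbr S v) f y = f u + f w)%N.
  by rewrite nv big_setU1 ?big_set1 // inE.
have -> (f : T -> nat) : (\sum_(y in nbr S x) f y = f u + f w)%N.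
  by rewrite nx big_setU1 ?big_set1 // inE.
rewrite nu in iso; rewrite nu nw nv nx setUid [[set u; w] :|: _]setUC.
by move: iso; set a := phi _; set b := phi _; clear; lia.
Qed.

(** * The main induction and its integer form *)

Lemma phi_set0 : phi set0 = 1%N.
Proof.
rewrite /phi; suff -> : maximal_diss set0 = [set set0] by rewrite cards1.
apply/setP => F; rewrite !inE.
apply/maxsetP/eqP => [[/andP[]]|->]; first by rewrite subset0 => /eqP.
split=> [|B /andP[]]; last by rewrite subset0 => /eqP.
by rewrite sub0set; apply/dissociationP => y; rewrite inE.
Qed.

Lemma rho_le1_C4_union S : rho S <= 1 /\ (rho S = 1 -> C4_union S).
Proof.
elim: {S}_.+1 {-2}S (ltnSn #|S|) => // n IHn S; rewrite ltnS => leSn.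
have IH : rho_le1_below S by move=> Q ltQ; case: (IHn Q (leq_trans ltQ leSn)).
(* Below 1 the equality clause is vacuous; every case ends this way except the empty set and a C_4
   component. *)
have strict q : rho S <= q -> q < 1 -> rho S <= 1 /\ (rho S = 1 -> C4_union S).
  move=> le_q q1; have lt1 := le_lt_trans le_q q1.
  by split=> [|e1]; [exact: ltW | rewrite e1 ltxx in lt1].
case: (boolP [exists u in S, deg S u <= 1]%N) => [/exists_inP[u Su du]|].
  by apply: strict (rho_deg_le1 IH Su du) _; lra.
rewrite negb_exists_in => /forall_inP deg2.
have {}deg2 w : w \in S -> (2 <= deg S w)%N by move/deg2; rewrite -ltnNge.
case: (boolP [exists u in S, 5 <= deg S u]%N) => [/exists_inP[u Su du]|].
  by apply: strict (rho_deg_ge5 IH deg2 Su du) _; lra.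
rewrite negb_exists_in => /forall_inP deg4.
case: (boolP [exists u in S, deg S u == 4]%N) => [/exists_inP[u Su /eqP du]|].
  by apply: strict (rho_deg4 IH deg2 Su du) _; lra.
rewrite negb_exists_in => /forall_inP deg4'.
have degS w : w \in S -> (2 <= deg S w <= 3)%N.
  move=> Sw; rewrite deg2 //=.
  by move: (deg4 w Sw) (deg4' w Sw); rewrite -ltnNge ltnS leq_eqVlt => /orP[->|].
have deg23 w : w \in S -> deg S w != 2%N -> deg S w = 3%N.
  by move=> Sw; case/andP: (degS w Sw); case: (deg S w) => [|[|[|[|]]]].
case: (boolP [exists u in S, deg S u == 2]%N) => [/exists_inP[u Su /eqP du]|]; last first.
  rewrite negb_exists_in => /forall_inP no2.
  have cubic w : w \in S -> deg S w = 3%N by move=> Sw; apply: deg23 => //; apply: no2.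
  case: (set_0Vmem S) => [->|[v Sv]]; last by apply: strict (lexx _) (rho_cubic IH cubic Sv).
  by rewrite /rho /weight phi_set0 cards0 mul1r; split=> // _; apply: C4_union0.
case: (boolP [exists w in S, (deg S w == 2) && [exists z in nbr S w, deg S z == 3]]%N).
  case/exists_inP=> w Sw /andP[/eqP dw /exists_inP[z wz /eqP dz]].
  by apply: strict (rho_deg2_deg3 IH degS Sw dw wz dz) _; lra.
rewrite negb_exists_in => /forall_inP no23.
(* No vertex of degree 2 has a neighbour of degree 3 any more, so the component of u is a cycle. *)
have reg w z : w \in S -> deg S w = 2%N -> z \in nbr S w -> deg S z = 2%N.
  move=> Sw dw wz; apply/eqP/negPn/negP => dz.
  have Sz : z \in S by move: wz; rewrite in_nbr => /andP[].
  have /negP := no23 w Sw; rewrite dw eqxx /=; apply; apply/exists_inP; exists z => //.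
  by rewrite deg23.
case: (rho_2regular IH Su du reg) => [[v [w [x]]]|le_q]; last by apply: strict le_q _; lra.
case=> [[Sv Sw Sx vx uw] nu nv nw nx].
set C := [set v; x] :|: [set u; w].
have CS : C \subset S by rewrite !subUset !sub1set Su Sv Sw Sx.
have euv : e u v by have : v \in nbr S u; [rewrite nu set21 | rewrite in_nbr => /andP[]].
have C4 : #|C| = 4%N.
  by rewrite /C -nu -nv card_nbrU // -/(deg S u) -/(deg S v) du (reg u) // nu set21.
have cardC : #|S| = (#|S :\: C| + 4)%N.
  by rewrite -(cardsID C S) (setIidPr CS) C4 addnC.
have [|le1 eq1] := IHn (S :\: C); first by apply: leq_trans leSn; rewrite cardC -addn1 leq_add2l.
(* The factor 6 of [phi_C4] cancels against t^4 = 1/6, contributed by the four deleted vertices. *)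
have le_rho : rho S <= rho (S :\: C).
  have le6 : (phi S)%:R <= 6 * (phi (S :\: C))%:R :> R.
    by rewrite -natrM ler_nat; apply: phi_C4.
  rewrite /rho /weight cardC exprD mulrA.
  have [[_ _ _ ->] _] := t_bounds.
  by have := ler_wpM2r (tX_ge0 #|S :\: C|) le6; lra.
split=> [|rho1]; first exact: le_trans le1.
apply: (C4_unionU (u := u) (v := v) (w := w) (x := x)) => //.
by apply: eq1; apply/le_anti; rewrite le1 -rho1 le_rho.
Qed.

(** Taking fourth powers eliminates t, since t^4 = 1/6, and leaves statements about natural
    numbers. *)
Lemma phi_le S : (phi S ^ 4 <= 6 ^ #|S|)%N /\ ((phi S ^ 4 = 6 ^ #|S|)%N -> C4_union S).
Proof.
have [le1 eq1] := rho_le1_C4_union S.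
have rho0 : 0 <= rho S := weight_ge0 S S.
have rho4 : rho S ^+ 4 = (phi S ^ 4)%:R / (6 ^ #|S|)%:R.
  rewrite /rho /weight exprMn -exprM mulnC exprM !natrX.
  by have [[_ _ _ ->] _] := t_bounds; rewrite div1r exprVn.
have pos : (0 : R) < (6 ^ #|S|)%:R by rewrite ltr0n expn_gt0.
split=> [|eq4].
  have : rho S ^+ 4 <= 1 by apply: exprn_ile1.
  by rewrite rho4 ler_pdivrMr // mul1r ler_nat.
apply: eq1; apply/eqP; rewrite -(@pexpr_eq1 _ _ 4) // rho4 eq4.
by rewrite divff // lt0r_neq0.
Qed.

(** A dissociation set of maximum cardinality is inclusion-maximal. *)
Lemma num_max_diss_le : (num_max_diss e <= phi setT)%N.
Proof.
apply/subset_leq_card/subsetP => F; rewrite !inE => /andP[dF /eqP cF].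
apply/maxsetP; rewrite subsetT; split=> // B /= /andP[_ dB] FB.
apply/esym/eqP; rewrite eqEcard FB cF.
exact: (@leq_bigmax_cond _ (dissociation e) (fun A : {set T} => #|A|)).
Qed.

Local Open Scope nat_scope.

(** * Disjoint unions of 4-cycles *)

Definition C4_adj (a b : 'I_4) := ((a : nat) == (b + 1) %% 4) || ((b : nat) == (a + 1) %% 4).

Lemma C4_union_embedding S : C4_union S ->
  4 %| #|S| /\ exists f : T -> nat * 'I_4,
  [/\ forall y, y \in S -> (f y).1 < #|S| %/ 4, {in S &, injective f}
    & {in S &, forall y z, e y z = ((f y).1 == (f z).1) && C4_adj (f y).2 (f z).2}].
Proof.
elim=> {S} [|S u v w x [Su Sv Sw Sx] vx uw nu nv nw nx _ [dvd4 [f [f_lt f_inj f_adj]]]].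
  by rewrite cards0; split=> //; exists (fun _ => (0, ord0)); split=> y; rewrite inE.
set C := [set v; x] :|: [set u; w] in dvd4 f_lt f_inj f_adj.
have CS : C \subset S by rewrite !subUset !sub1set Su Sv Sw Sx.
have neq y z : z \in nbr S y -> (y == z) = false.
  by apply: contraTF => /eqP->; apply: nbr_self.
have [uv ux] : (u == v) = false /\ (u == x) = false by rewrite !neq ?nu ?set21 ?set22.
have [wv wx] : (w == v) = false /\ (w == x) = false by rewrite !neq ?nw ?set21 ?set22.
have {}vx := negPf vx; have {}uw := negPf uw.
have sym_neq y z : (y == z) = false -> (z == y) = false by rewrite eq_sym.
have ne := (uv, ux, uw, wv, wx, vx, (sym_neq _ _ uv, sym_neq _ _ ux, sym_neq _ _ uw,
  sym_neq _ _ wv, sym_neq _ _ wx, sym_neq _ _ vx)).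
have euv : e u v by have : v \in nbr S u; [rewrite nu set21 | rewrite in_nbr => /andP[]].
have C4 : #|C| = 4 by rewrite /C -nu -nv card_nbrU // nu nv !cards2 !ne.
have cardS : #|S| = #|S :\: C| + 4 by rewrite -(cardsID C S) (setIidPr CS) C4 addnC.
pose k := #|S :\: C| %/ 4.
have divS : #|S| %/ 4 = k.+1 by rewrite cardS divnDr // addn1.
pose g y : 'I_4 := if y == u then inord 0 else if y == v then inord 1
                   else if y == w then inord 2 else inord 3.
have inC y : y \in C -> [\/ y = u, y = v, y = w | y = x].
  by rewrite !inE -orbA => /or4P[] /eqP ->; [apply: Or42 | apply: Or44 | apply: Or41 | apply: Or43].
have g_inj : {in C &, injective g}.
  move=> y z /inC[] -> /inC[] -> //; rewrite /g ?eqxx ?ne => /(congr1 (@nat_of_ord 4));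
  by rewrite !inordK.
have g_adj : {in C &, forall y z, e y z = C4_adj (g y) (g z)}.
  move=> y z Cy Cz; have -> : e y z = (z \in nbr S y) by rewrite in_nbr (subsetP CS).
  by case/inC: Cy => ->; case/inC: Cz => ->; rewrite ?(nu, nv, nw, nx) !inE /g ?eqxx ?ne
    /C4_adj ?inordK.
have no_edge y z : y \in C -> z \in S -> z \notin C -> e y z = false.
  move=> Cy Sz nCz; have -> : e y z = (z \in nbr S y) by rewrite in_nbr Sz.
  apply: contraNF nCz; rewrite !in_setU.
  by case/inC: Cy => ->; rewrite ?nu ?nv ?nw ?nx in_setU => ->; rewrite ?orbT.
have f_ltk y : y \in S -> y \notin C -> (f y).1 < k by move=> Sy nCy; rewrite f_lt // inE nCy.
split; first by rewrite cardS dvdn_addl.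
exists (fun y => if y \in C then (k, g y) else f y); split.
- move=> y Sy; rewrite divS; case: ifP => // /negbT nCy.
  exact: leq_trans (f_ltk y Sy nCy) _.
- move=> y z Sy Sz; case: ifP => Cy; case: ifP => Cz.
  + by case; apply: g_inj.
  + by move=> fz; have := f_ltk z Sz (negbT Cz); rewrite -fz ltnn.
  + by move=> fy; have := f_ltk y Sy (negbT Cy); rewrite fy ltnn.
  + by apply: f_inj; rewrite inE ?Cy ?Cz.
- move=> y z Sy Sz; case: ifP => Cy; case: ifP => Cz /=.
  + by rewrite eqxx g_adj.
  + by rewrite no_edge ?Cz // gtn_eqF // f_ltk ?Cz.
  + by rewrite sym_e no_edge ?Cy // ltn_eqF // f_ltk ?Cy.
  + by rewrite f_adj // inE ?Cy ?Cz.
Qed.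

Lemma C4_union_isomorphic : C4_union setT ->
  4 %| #|T| /\ isomorphic e (C4_union_rel (#|T| %/ 4)).
Proof.
case/C4_union_embedding; rewrite cardsT => dvd4 [f [f_lt f_inj f_adj]]; split=> //.
pose g y : 'I_(#|T| %/ 4) * 'I_4 := (Ordinal (f_lt y (in_setT y)), (f y).2).
exists g; split=> [|y z]; last by rewrite f_adj.
apply: inj_card_bij; last by rewrite card_prod !card_ord divnK.
move=> y z [fyz1 fyz2]; apply: f_inj => //.
by rewrite [f y]surjective_pairing [f z]surjective_pairing fyz1 fyz2.
Qed.

End Counting.

(** * Lower bound: k disjoint 4-cycles have at least 6^k maximum dissociation sets *)

Lemma C4_diss_le2 (B : {set 'I_4}) :
  (forall a b c, a \in B -> b \in B -> c \in B -> C4_adj a b -> C4_adj a c -> b = c) ->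
  #|B| <= 2.
Proof.
move=> dB; pose o (i : nat) : 'I_4 := inord i.
(* Any three vertices of C_4 induce a path; its centre i has the distinct neighbours j and k, so the
   three cannot all lie in B. *)
have no i j k : i < 4 -> j < 4 -> k < 4 -> C4_adj (o i) (o j) -> C4_adj (o i) (o k) ->
    j != k -> ~~ [&& o i \in B, o j \in B & o k \in B].
  move=> i4 j4 k4 ij ik jk; apply/and3P => -[Bi Bj Bk].
  have /(congr1 (@nat_of_ord 4)) := dB _ _ _ Bi Bj Bk ij ik.
  by rewrite !inordK //; apply/eqP.
have adj i j : i < 4 -> j < 4 -> C4_adj (o i) (o j) = (i == (j + 1) %% 4) || (j == (i + 1) %% 4).
  by move=> i4 j4; rewrite /C4_adj !inordK.
have := no 0 1 3; have := no 1 0 2; have := no 2 1 3; have := no 3 2 0.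
rewrite !adj //= => /(_ isT isT isT isT isT isT) n3 /(_ isT isT isT isT isT isT) n2.
move=> /(_ isT isT isT isT isT isT) n1 /(_ isT isT isT isT isT isT) n0.
have -> : #|B| = (o 0 \in B) + (o 1 \in B) + (o 2 \in B) + (o 3 \in B).
  transitivity (\sum_(i < 4) (o i \in B : nat)); last by rewrite !big_ord_recr big_ord0.
  by rewrite -sum1_card big_mkcond; apply: eq_bigr => i _; rewrite /o inord_val; case: ifP.
by move: n0 n1 n2 n3; do 4![case: (_ \in B)].
Qed.

Section Attained.

Variables (T : finType) (e : rel T) (k : nat) (f : T -> 'I_k * 'I_4) (g : 'I_k * 'I_4 -> T).
Hypotheses (fK : cancel f g) (gK : cancel g f).
Hypothesis f_adj : forall x y, C4_union_rel k (f x) (f y) = e x y.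

Lemma adj_g i j a b : e (g (i, a)) (g (j, b)) = (i == j) && C4_adj a b.
Proof. by rewrite -f_adj !gK. Qed.

Definition fibre (F : {set T}) i := [set a | g (i, a) \in F].

Lemma card_fibres (F : {set T}) : #|F| = \sum_i #|fibre F i|.
Proof.
rewrite -sum1_card (reindex g) /=; last by exists f => x _; [apply: gK | apply: fK].
rewrite big_mkcond (eq_bigr (fun i => \sum_(a in fibre F i) 1)) => [|i _]; last first.
  by rewrite sum1_card.
rewrite (eq_bigr (fun p => if g (p.1, p.2) \in F then 1 else 0)) => [|[] //].
rewrite -(pair_bigA _ (fun i a => if g (i, a) \in F then 1 else 0)) /=.
by apply: eq_bigr => i _; rewrite [RHS]big_mkcond; apply: eq_bigr => a _; rewrite inE.
Qed.

Lemma card_dissociation_le (F : {set T}) : dissociation e F -> #|F| <= 2 * k.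
Proof.
move/dissociationP => dF; rewrite card_fibres.
apply: (@leq_trans (\sum_(i < k) 2)); last by rewrite sum_nat_const card_ord mulnC.
apply: leq_sum => i _; apply: C4_diss_le2 => a b c; rewrite !inE => Fa Fb Fc ab ac.
have : g (i, b) = g (i, c) by apply: (dF (g (i, a))); rewrite ?adj_g ?eqxx.
by move/(can_inj gK) => -[].
Qed.

Definition of_pairs (G : {ffun 'I_k -> {set 'I_4}}) : {set T} :=
  [set x | (f x).2 \in G (f x).1].

Lemma fibre_of_pairs G i : fibre (of_pairs G) i = G i.
Proof. by apply/setP => a; rewrite !inE gK. Qed.

(** Neighbours of a vertex of the set lie in its own copy of C_4, where only one other vertex was
    chosen; thus any pair is allowed, adjacent or not. *)
Lemma of_pairs_dissociation (G : {ffun 'I_k -> {set 'I_4}}) :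
  (forall i, #|G i| = 2) -> dissociation e (of_pairs G).
Proof.
move=> G2; apply/dissociationP => x y z.
rewrite -(fK x) -(fK y) -(fK z); case: (f x) (f y) (f z) => [i a] [j b] [l c].
rewrite !inE !gK /= !adj_g => Ga Gb Gc /andP[/eqP ij ab] /andP[/eqP il ac].
rewrite -{}ij in Gb *; rewrite -{}il in Gc *; congr (g (_, _)).
have nadj d : C4_adj a d -> d \in G i -> d \in G i :\ a.
  move=> ad Gd; rewrite !inE Gd andbT; apply: contraTneq ad => ->.
  by case: a {Ga ab ac} => [[|[|[|[|]]]]].
have : #|G i :\ a| <= 1 by move: (G2 i); rewrite (cardsD1 a) Ga add1n => -[->].
by move/card_le1_eqP; apply; apply: nadj.
Qed.

(** Choosing two of the four vertices in each copy gives 6^k distinct dissociation sets of size 2k,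
    and no dissociation set is larger. *)
Lemma num_max_diss_ge : 6 ^ k <= num_max_diss e.
Proof.
pose pairs := [set A : {set 'I_4} | #|A| == 2].
have -> : 6 ^ k = #|ffun_on (mem pairs) : {pred {ffun 'I_k -> {set 'I_4}}}|.
  by rewrite card_ffun_on card_ord card_draws card_ord.
rewrite -(card_in_image (f := of_pairs)); last first.
  by move=> G H _ _ GH; apply/ffunP => i; rewrite -!fibre_of_pairs GH.
apply/subset_leq_card/subsetP => _ /imageP[G /ffun_onP G2 ->].
have {}G2 i : #|G i| = 2 by move: (G2 i); rewrite inE => /eqP.
have dG := of_pairs_dissociation G2.
rewrite inE /max_dissociation dG eqn_leq.
rewrite (@leq_bigmax_cond _ (dissociation e) (fun A : {set T} => #|A|)) //=.
apply/bigmax_leqP => F /card_dissociation_le leF; apply: leq_trans leF _.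
rewrite card_fibres (eq_bigr (fun _ => 2)) => [|i _]; last by rewrite fibre_of_pairs.
by rewrite sum_nat_const card_ord mulnC.
Qed.

End Attained.

(** Supplies a concrete ordered field for the weights: two square roots in [realalg] produce t =
    6^(-1/4). *)
Lemma exists_fourth_root6 :
  exists2 t : realalg, (0 < t)%R & (6 * t ^+ 4 = 1)%R.
Proof.
have s0 : (0 < Num.sqrt (6 : realalg)^-1)%R by rewrite sqrtr_gt0 invr_gt0 ltr0n.
exists (Num.sqrt (Num.sqrt 6^-1))%R; first by rewrite sqrtr_gt0.
rewrite (exprM _ 2 2) !sqr_sqrtr ?(ltW s0) // ?invr_ge0 ?ler0n //.
by rewrite divff // pnatr_eq0.
Qed.

(* phi'(G) <= 6^(n/4) is stated as phi'(G)^4 <= 6^n (equivalent over naturals). *)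
Theorem theorem1p4 (T : finType) (e : rel T) :
  simple_graph e -> triangle_free e ->
  (num_max_diss e) ^ 4 <= 6 ^ #|T| /\
  ((num_max_diss e) ^ 4 = 6 ^ #|T| <->
     (4 %| #|T|) /\ isomorphic e (C4_union_rel (#|T| %/ 4))).
Proof.
move=> [sym_e irr_e] tf_e; have [t t_gt0 t4] := exists_fourth_root6.
have := phi_le sym_e irr_e tf_e t_gt0 t4 setT; rewrite cardsT => -[le_phi eq_phi].
have le_num : num_max_diss e ^ 4 <= phi e setT ^ 4 by rewrite leq_exp2r ?num_max_diss_le.
have le6 := leq_trans le_num le_phi.
split=> //; split=> [eq6 | [dvd4 [f [[g fK gK] f_adj]]]].
  (* The fourth power of [phi e setT] lies between that of phi'(G) and 6^n, so equality of the outer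
     two forces equality for [phi]. *)
  apply: C4_union_isomorphic => //; apply: eq_phi.
  by apply/eqP; rewrite eqn_leq le_phi -eq6 le_num.
(* As 4 divides n, 6^n is the fourth power of 6^(n/4), and only 6^(n/4) <= phi'(G) remains. *)
apply/eqP; rewrite eqn_leq le6 /= -{1}(divnK dvd4) expnM leq_exp2r //.
exact: num_max_diss_ge fK gK f_adj.
Qed.
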